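(* For each $n\ge 5$ let $G^{(2)}_n=K_2\vee (K_{n-4}+2K_1)$. (1) Let $G$ be a graph on $n\geq 14$ vertices with minimum degree $\delta(G)\geq 2$. If $\rho(G)\geq \rho(G^{(2)}_n)$, then $G$ contains a Hamilton cycle unless $G$ is isomorphic to $G^{(2)}_n$. (2) For $n=7$, $\rho(K_3\vee 4K_1)>\rho(G^{(2)}_7)$ and $K_3\vee 4K_1$ contains no Hamilton cycle. For $n=9$, $\rho(K_4\vee 5K_1)>\rho(G^{(2)}_{9})$ and $K_4\vee 5K_1$ contains no Hamilton cycle.
   Context: All graphs are finite, simple and undirected. The spectral radius $\rho(G)$ of a graph $G$ is the largest eigenvalue of its adjacency matrix. $K_n$ is the complete graph on $n$ vertices. $G_1+G_2$ denotes the disjoint union of two graphs, $kG$ denotes the union of $k$ disjoint copies of $G$, and the join $G_1\vee G_2$ is obtained from $G_1+G_2$ by joining each vertex of $G_1$ to each vertex of $G_2$. A Hamilton cycle is a cycle containing all vertices of the graph. *)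

(* Defs.v *)
From mathcomp Require Import all_boot all_order all_algebra.
From mathcomp Require Import boolp classical_sets reals.
From mathcomp Require complex.
Set Implicit Arguments.
Unset Strict Implicit.
Unset Printing Implicit Defensive.
Import Order.TTheory GRing.Theory Num.Theory.

Record sgraph := SGraph {
  vertex :> finType;
  edge : rel vertex;
  edge_sym : symmetric edge;
  edge_irrefl : irreflexive edge }.

Arguments edge {_}.

Section GraphNotions.
Variable G : sgraph.

Definition degree (x : G) : nat := #|[set y : G | edge x y]|.

(* The starting value #|G| exceeds every degree, so it plays no role as soon as
   G has a vertex. *)
Definition min_degree : nat := \big[minn/#|G|]_(x : G) degree x.

(* [cycle] and [uniq] alone would also accept a single edge walked back and
   forth, hence the length condition. *)
Definition is_graph_cycle (c : seq G) : bool :=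
  [&& 3 <= size c, cycle edge c & uniq c].

Definition hamiltonian : Prop :=
  exists c : seq G, is_graph_cycle c /\ forall x : G, x \in c.

Definition adjacency (R : nzRingType) : 'M[R]_#|G| :=
  (\matrix_(i, j) (edge (enum_val i) (enum_val j))%:R)%R.

End GraphNotions.

(* For a graph with at least one vertex this supremum is a maximum: see
   [spectral_radius_max] below. *)
Definition spectral_radius (R : realType) (G : sgraph) : R :=
  sup [set a : R | eigenvalue (adjacency G R) a]%classic.

Definition isomorphic (G H : sgraph) : Prop :=
  exists f : G -> H, bijective f /\ forall x y, edge (f x) (f y) = edge x y.

Definition complete_rel (n : nat) : rel 'I_n := fun i j => i != j.
Lemma complete_sym n : symmetric (@complete_rel n).
Proof. by move=> i j; rewrite /complete_rel eq_sym. Qed.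
Lemma complete_irrefl n : irreflexive (@complete_rel n).
Proof. by move=> i; rewrite /complete_rel eqxx. Qed.
Definition complete_graph (n : nat) : sgraph :=
  SGraph (@complete_sym n) (@complete_irrefl n).

Section DisjointUnionAndJoin.
Variables G1 G2 : sgraph.

(* [b] says whether vertices of different summands are adjacent. *)
Definition sum_rel (b : bool) : rel (G1 + G2)%type := fun u v =>
  match u, v with
  | inl x, inl y => edge x y
  | inr x, inr y => edge x y
  | _, _ => b
  end.
Lemma sum_rel_sym b : symmetric (sum_rel b).
Proof. by move=> [x|x] [y|y] //=; rewrite edge_sym. Qed.
Lemma sum_rel_irrefl b : irreflexive (sum_rel b).
Proof. by move=> [x|x] /=; rewrite edge_irrefl. Qed.

Definition disjoint_union : sgraph :=
  SGraph (sum_rel_sym false) (sum_rel_irrefl false).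
Definition graph_join : sgraph :=
  SGraph (sum_rel_sym true) (sum_rel_irrefl true).

End DisjointUnionAndJoin.

Section Copies.
Variables (k : nat) (G : sgraph).

Definition copies_rel : rel ('I_k * G)%type := fun u v =>
  (u.1 == v.1) && edge u.2 v.2.
Lemma copies_sym : symmetric copies_rel.
Proof. by move=> u v; rewrite /copies_rel eq_sym edge_sym. Qed.
Lemma copies_irrefl : irreflexive copies_rel.
Proof. by move=> u; rewrite /copies_rel edge_irrefl andbF. Qed.
Definition copies : sgraph := SGraph copies_sym copies_irrefl.

End Copies.

(* K_2 \/ (K_(n-4) + 2 K_1).  It has n vertices when 4 <= n; below that the
   subtraction is truncated. *)
Definition G2 (n : nat) : sgraph :=
  graph_join (complete_graph 2)
    (disjoint_union (complete_graph (n - 4)) (copies 2 (complete_graph 1))).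

Section SpectralRadius.
Import complex.
Local Open Scope ring_scope.
Local Open Scope complex_scope.

Lemma hermitian_eigenvalue_real (C : numClosedFieldType) n (A : 'M[C]_n) a :
  map_mx Num.conj A^T = A -> eigenvalue A a -> a \is Num.real.
Proof.
move=> hA /eigenvalueP[v vA v0]; rewrite CrealE.
pose w : 'cV_n := map_mx Num.conj v^T.
have Aw : A *m w = Num.conj a *: w.
  by rewrite /w -{1}hA -map_mxM -trmx_mul vA linearZ /= map_mxZ.
have E : a *: (v *m w) = Num.conj a *: (v *m w).
  by rewrite scalemxAl -vA -mulmxA Aw -scalemxAr.
have nz : (v *m w) 0 0 != 0.
  have E0 : (v *m w) 0 0 = \sum_j `|v 0 j| ^+ 2.
    by rewrite mxE; apply: eq_bigr => j _; rewrite !mxE normCK.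
  rewrite E0 psumr_eq0; last by move=> j _; rewrite exprn_ge0.
  apply: contra v0 => /allP h; apply/eqP/rowP => j; rewrite mxE; apply/eqP.
  by have := h j (mem_index_enum _); rewrite /= sqrf_eq0 normr_eq0.
have /(mulIf nz) <- // : a * (v *m w) 0 0 = Num.conj a * (v *m w) 0 0.
by have := congr1 (fun M : 'M_1 => M 0 0) E; rewrite mxE [RHS]mxE.
Qed.

Lemma spectral_radius_max (R : realType) (G : sgraph) : (0 < #|G|)%N ->
  eigenvalue (adjacency G R) (spectral_radius R G) /\
  forall a, eigenvalue (adjacency G R) a -> a <= spectral_radius R G.
Proof.
move=> G0; set A := adjacency G R.
pose toC : {rmorphism R -> R[i]} := real_complex R.
have hA : map_mx Num.conj (map_mx toC A)^T = map_mx toC A.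
  apply/matrixP => i j; rewrite !mxE edge_sym.
  by case: edge; rewrite ?rmorph1 ?rmorph0.
have ex0 : exists x, eigenvalue A x.
  have := @closed_rootP _ (char_poly (map_mx toC A)).
  rewrite size_char_poly eqSS -lt0n G0 => /elimT/(_ isT)[z].
  rewrite -eigenvalue_root_char => ez.
  have /complex_realP[x zx] := hermitian_eigenvalue_real hA ez.
  by exists x; rewrite -(eigenvalue_map toC); rewrite zx in ez.
have [s hs] : exists s : seq R, forall x, eigenvalue A x = (x \in s).
  have p0 : char_poly A != 0 by rewrite monic_neq0 ?char_poly_monic.
  have [r hr] := closed_field_poly_normal (map_poly toC (char_poly A)).
  exists [seq complex.Re z | z <- r & z \is Num.real] => x.
  have xr : eigenvalue A x = (toC x \in r).
    rewrite eigenvalue_root_char -(fmorph_root toC) hr rootZ.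
      by rewrite root_prod_XsubC.
    by rewrite lead_coef_eq0 map_poly_eq0.
  rewrite xr; apply/idP/mapP => [xin|[z]].
    by exists (toC x) => //; rewrite mem_filter xin andbT; apply/complex_realP; exists x.
  by rewrite mem_filter => /andP[zR zin ->]; rewrite /toC /= RRe_real.
have [m ms mub] : exists2 m, m \in s & forall x, x \in s -> x <= m.
  have [x0] := ex0; rewrite hs; elim: s {hs} x0 => // a [|b s] IH x0 _.
    by exists a; rewrite ?mem_head // => x; rewrite inE => /eqP ->.
  have [m ms mub] := IH b (mem_head _ _).
  case: (lerP m a) => [ma|/ltW am].
    exists a; first exact: mem_head.
    move=> x; rewrite inE => /orP[/eqP->//|/mub xm]; exact: le_trans ma.
  exists m; first by rewrite inE ms orbT.
  by move=> x; rewrite inE => /orP[/eqP->//|/mub].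
have ub : forall a, eigenvalue A a -> a <= m by move=> a; rewrite hs; apply: mub.
have em : eigenvalue A m by rewrite hs.
suff -> : spectral_radius R G = m by [].
apply/eqP; rewrite eq_le; apply/andP; split.
  by apply: ge_sup; [exists m | move=> a /ub].
by apply: ub_le_sup; [exists m => a /ub | ].
Qed.

End SpectralRadius.

(* Main.v *)
(** The graph [G2 n] contains [K_(n-2)] properly, so its spectral radius exceeds
    [n - 3].  Summing the rows of [A^2 - A] against the Perron vector gives
    [rho^2 - rho <= 2m - 2(n - 1)] for a graph with minimum degree 2, hence [G]
    misses at most [2n - 6] edges.  If [G] is not Hamiltonian, pass to its
    Bondy-Chvatal closure and take a nonadjacent pair of maximal degree sum with
    smaller degree [k]: there are [k] vertices of degree at most [k] and [n - k]
    of degree at most [n - 1 - k], which for [k >= 3] costs too many edges.  So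
    two vertices [u], [v] have degree 2; in the closure the other vertices form a
    clique and meet [u] and [v] in the same set.  Therefore [G] is contained in
    [G2 n] or in [K_1 \/ (K_(n-3) + K_2)].  In the first case the maximality of
    the spectral radius forces equality; in the second case replacing the edge
    [uv] by [ub] and [vb], where the Perron vector satisfies [x_b >= x_u = x_v],
    yields [G2 n] and strictly increases the spectral radius. *)

Require Import Defs.
From mathcomp Require Import all_boot all_order all_algebra reals.
From mathcomp Require Import boolp.
From mathcomp Require classical_sets complex.
From mathcomp Require Import zify ring lra.
Set Implicit Arguments.
Unset Strict Implicit.
Unset Printing Implicit Defensive.

(** * Hamilton cycles, closure and structure *)

Definition hamiltonian_rel (T : finType) (e : rel T) : Prop :=
  exists c : seq T, [&& 3 <= size c, cycle e c & uniq c] /\ forall x, x \in c.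

Definition rdegree (T : finType) (e : rel T) (x : T) : nat :=
  #|[set y | e x y]|.

Definition add_edge (T : eqType) (e : rel T) (u v : T) : rel T := fun x y =>
  [|| e x y, (x == u) && (y == v) | (x == v) && (y == u)].

(** * Ore's argument and the Bondy-Chvatal closure *)

Lemma cycle_next_break (T : eqType) (e : rel T) (c : seq T) :
  uniq c -> ~~ cycle e c -> exists2 x, x \in c & ~~ e x (next c x).
Proof.
move=> Uc nc; apply/hasP; apply: contraR nc => /hasPn h.
by apply: cycle_from_next => // x /h; rewrite negbK.
Qed.

(* The crossing pigeonhole of Ore's argument: along the path [x :: s], some edge
   goes from a point of [Q] to a point of [P]. *)
Lemma count_split (T : Type) (P Q : pred T) (x : T) (s : seq T) :
  size s < count P s + count Q (belast x s) ->
  exists s1 y s2, [/\ s = s1 ++ y :: s2, P y & Q (last x s1)].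
Proof.
elim: s x => [|y s IH] x //=.
have [/andP[Py Qx] _|nPQ h] := boolP (P y && Q x).
  by exists [::], y, s.
have [|s1 [z [s2 [-> Pz Qz]]]] := IH y.
  by move: h nPQ; case: (P y); case: (Q x) => /=; lia.
by exists (y :: s1), z, s2.
Qed.

Lemma rdegree_count (T : finType) (e : rel T) (x : T) (s : seq T) :
  uniq s -> (forall y, e x y -> y \in s) -> count (e x) s = rdegree e x.
Proof.
move=> Us h; rewrite -size_filter /rdegree -(card_uniqP (filter_uniq _ Us)).
by apply: eq_card => y; rewrite mem_filter inE andb_idr //; apply: h.
Qed.

(** The degree sum forces consecutive vertices x, y on the path with [u] adjacent to y and the last
    vertex [v] adjacent to x. Walking from [u] to x, jumping to [v] and returning backwards to y
    closes up into a Hamilton cycle. *)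
Lemma hamiltonian_path_cycle (T : finType) (e : rel T) (u : T) (s : seq T) :
  symmetric e -> irreflexive e -> path e u s -> uniq (u :: s) ->
  (forall x, x \in u :: s) -> 1 < size s ->
  #|T| <= rdegree e u + rdegree e (last u s) -> hamiltonian_rel e.
Proof.
move=> es ei ps Us cov sz dsum; set v := last u s.
have cT : #|T| = (size s).+1.
  rewrite -[RHS]/(size (u :: s)) -(card_uniqP Us).
  by apply: eq_card => x; rewrite cov.
have du : count (e u) s = rdegree e u.
  apply: rdegree_count; first by case/andP: Us.
  by move=> y; have := cov y; rewrite inE => /orP[/eqP->|//]; rewrite ei.
have dv : count (e v) (belast u s) = rdegree e v.
  apply: rdegree_count; first by move: Us; rewrite lastI rcons_uniq => /andP[].
  move=> y; have := cov y; rewrite lastI mem_rcons inE => /orP[/eqP->|//].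
  by rewrite ei.
have [|s1 [y [s2 [sE uy vx]]]] := @count_split _ (e u) (e v) u s.
  by rewrite du dv -cT.
exists (u :: s1 ++ rev (y :: s2)); split; last first.
  by move=> x; have := cov x; rewrite sE !inE !mem_cat mem_rev.
have perm : perm_eq (u :: s1 ++ rev (y :: s2)) (u :: s).
  by rewrite perm_cons sE perm_cat2l perm_rev.
rewrite (perm_uniq perm) (perm_size perm) Us andbT /= ltnS sz /=.
have vE : v = last y s2 by rewrite /v sE last_cat.
have revE : rev (y :: s2) = v :: rev (belast y s2).
  by rewrite lastI rev_rcons -vE.
move: ps; rewrite sE cat_path /= => /and3P[ps1 _ ps2].
rewrite rcons_cat cat_path ps1 revE /= es vx rcons_path.
have -> : last v (rev (belast y s2)) = y.
  by rewrite -[LHS]/(last u (v :: _)) -revE rev_cons last_rcons.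
by rewrite (es y) uy vE rev_path (eq_path (e' := e)) ?ps2.
Qed.

(** A Hamilton cycle through the new edge, cut at that edge, is a Hamilton path of the old graph
    between [u] and [v], so [hamiltonian_path_cycle] applies. *)
Lemma hamiltonian_add_edge (T : finType) (e : rel T) (u v : T) :
  symmetric e -> irreflexive e -> #|T| <= rdegree e u + rdegree e v ->
  hamiltonian_rel (add_edge e u v) -> hamiltonian_rel e.
Proof.
move=> es ei dsum [c [/and3P[sz cyc Uc] cov]].
have [cyc'|nc] := boolP (cycle e c); first by exists c; rewrite sz cyc' Uc.
have [x xc nx] := cycle_next_break Uc nc.
have [i s cE] := rot_to xc.
have {}nx : ~~ e x (next (x :: s) x) by rewrite -cE next_rot.
rewrite -(rot_cycle i) cE in cyc; rewrite -(rot_uniq i) cE in Uc.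
rewrite -(size_rot i) cE in sz.
have {}cov z : z \in x :: s by rewrite -cE mem_rot.
case: s cE cyc Uc nx sz cov => [//|y [//|z s]] _ cyc Uc nx _ cov.
rewrite /= eqxx in nx; case/andP: cyc => xy cyc.
have uvE : (x == u) && (y == v) || (x == v) && (y == u).
  by move: xy; rewrite /add_edge (negPf nx).
(* The new edge joins [x] and [y]. It is not the edge from [y] to [z], since a cycle of length at
   least 3 has [z] different from [x]; the edges after that avoid [y] altogether. *)
have p : path e y (rcons (z :: s) x).
  have Uy : y \notin rcons (z :: s) x.
    move: Uc; rewrite /= !(inE, mem_rcons) !negb_or.
    by case/and4P=> /and3P[/[1!eq_sym] -> _ _] /andP[-> ->].
  move: Uc cyc Uy; rewrite /= !(inE, mem_rcons) !negb_or.
  case/and4P=> /and3P[xney xnez xs] _ _ _ /andP[yz pz] /and3P[yx ynz ys].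
  apply/andP; split.
    case/orP: yz => // yz; move: yz uvE xney xnez ynz.
    by case/orP=> /andP[/eqP ? /eqP ?] /orP[]/andP[/eqP ? /eqP ?]
      /eqP ? /eqP ? /eqP ?; congruence.
  apply: (sub_in_path (P := predC1 y)) pz; last first.
    rewrite /= all_rcons /= (eq_sym z) (eq_sym x) ynz yx /=; apply/allP => w ws.
    by apply: contraNneq ys => <-.
  move=> a b /= /eqP ay /eqP bay; rewrite /add_edge => /orP[//|].
  case/orP: uvE => /andP[/eqP ? /eqP ?] /orP[]/andP[/eqP ? /eqP ?]; congruence.
apply: (hamiltonian_path_cycle es ei p) => //.
- by rewrite -rcons_cons rcons_uniq -cons_uniq.
- by move=> w; rewrite -rcons_cons mem_rcons.
- by rewrite /= size_rcons.
rewrite last_rcons; case/orP: uvE => /andP[/eqP-> /eqP->] //.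
by rewrite addnC.
Qed.

Lemma hamiltonian_complete (T : finType) (e : rel T) :
  3 <= #|T| -> (forall x y, x != y -> e x y) -> hamiltonian_rel e.
Proof.
move=> T3 ee; exists (enum T); split; last by move=> x; rewrite mem_enum.
rewrite -cardE T3 enum_uniq andbT /=.
apply: contraTT T3 => nc.
have [x xc] := cycle_next_break (enum_uniq T) nc.
have [i s cE] := rot_to xc.
rewrite -(next_rot i) ?enum_uniq // cE cardE -(size_rot i) cE -leqNgt.
have := enum_uniq T; rewrite -(rot_uniq i) cE.
case: s {cE} => [|y s] //=; rewrite eqxx inE negb_or -!andbA => /andP[xy _].
by rewrite ee.
Qed.

Lemma rdegree_subrel (T : finType) (e e' : rel T) (x : T) :
  subrel e e' -> rdegree e x <= rdegree e' x.
Proof. by move=> ee; apply/subset_leq_card/subsetP => y; rewrite !inE; apply: ee. Qed.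

(** Edges are added between non-adjacent vertices of degree sum at least [#|T|] as long as there are
    any. By [hamiltonian_add_edge] no Hamilton cycle appears, and the number of non-adjacent pairs
    drops each time. *)
Lemma ore_closure (T : finType) (e : rel T) :
  symmetric e -> irreflexive e -> ~ hamiltonian_rel e ->
  exists e' : rel T, [/\ symmetric e', irreflexive e', subrel e e',
    ~ hamiltonian_rel e' &
    forall u v, u != v -> ~~ e' u v -> rdegree e' u + rdegree e' v < #|T|].
Proof.
have [m] := ubnP #|[pred p : T * T | ~~ e p.1 p.2]|.
elim: m e => // m IH e /ltnSE lem es ei nh.
have [/existsP[u /existsP[v /and3P[uv nuv d]]]|/existsPn h] :=
  boolP [exists u, exists v, [&& u != v, ~~ e u v & #|T| <= rdegree e u + rdegree e v]];
  last first.
  exists e; split=> // u v uv nuv; rewrite ltnNge; apply: contra (h u) => d.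
  by apply/existsP; exists v; rewrite uv nuv.
have [||||e' [es' ei' ee' nh' cl]] := IH (add_edge e u v).
- apply: leq_trans lem; apply: proper_card; apply/properP; split.
    by apply/subsetP => p; rewrite !inE /add_edge negb_or => /andP[].
  by exists (u, v); rewrite !inE ?nuv //= /add_edge !eqxx orbT.
- by move=> x y; rewrite /add_edge es; congr (_ || _); do 4!case: (_ == _).
- move=> x; rewrite /add_edge ei /=; apply/negP.
  by case/orP=> /andP[/eqP E1 /eqP E2]; move/eqP: uv; congruence.
- by move/(hamiltonian_add_edge es ei d).
by exists e'; split=> // x y xy; apply: ee'; rewrite /add_edge xy.
Qed.

(* [K_2 \/ (K_(n-4) + 2 K_1)] with [K_2] on [a], [b] and [2 K_1] on [u], [v]. *)
Definition split_join_rel (T : eqType) (a b u v : T) : rel T := fun x y =>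
  (x != y) && [|| x \in [:: a; b], y \in [:: a; b]
                | (x \notin [:: u; v]) && (y \notin [:: u; v])].

(* [K_1 \/ (K_(n-3) + K_2)] with [K_1] on [a] and [K_2] on [u], [v]. *)
Definition pendant_triangle_rel (T : eqType) (a u v : T) : rel T := fun x y =>
  (x != y) && [|| x == a, y == a | ~~ ((x \in [:: u; v]) (+) (y \in [:: u; v]))].

(** With n = 2k + 1 + m the inequality becomes k^2 - 7k + 7 + m(2k - 4) <= 0. This fails at once for
    k >= 7; for k from 3 to 6 it fails because n >= 14 gives m >= 13 - 2k. *)
Lemma degree_sum_contra (n k : nat) : 14 <= n -> 3 <= k -> 2 * k + 1 <= n ->
  n * n + 11 + k * (n - 1 - k) + (n - k - k) * k <= n * (n - 1) + 5 * n -> False.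
Proof.
move=> n14 k3 kn2 f.
have [m mE] : exists m, n = 2 * k + 1 + m by exists (n - (2 * k + 1)); lia.
rewrite mE in f n14.
have E1 : 2 * k + 1 + m - 1 - k = k + m by lia.
have E2 : 2 * k + 1 + m - k - k = m.+1 by lia.
have E3 : 2 * k + 1 + m - 1 = 2 * k + m by lia.
rewrite E1 E2 E3 in f.
have [k7|k7] := leqP 7 k; first by nia.
have : k \in [:: 3; 4; 5; 6] by rewrite !inE; lia.
by rewrite !inE => /or4P[] /eqP kE; rewrite kE in f n14; lia.
Qed.

(** * Structure of closed non-Hamiltonian graphs with few missing edges *)

Section Closed.
Variables (T : finType) (e : rel T).
Hypotheses (es : symmetric e) (ei : irreflexive e) (nh : ~ hamiltonian_rel e).
Hypothesis closed :
  forall u v, u != v -> ~~ e u v -> rdegree e u + rdegree e v < #|T|.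
Hypothesis d2 : forall x, 2 <= rdegree e x.
Hypothesis n14 : 14 <= #|T|.
Hypothesis big : #|T| * #|T| + 11 <= \sum_x rdegree e x + 5 * #|T|.

Lemma card_nonadjacent (x : T) :
  rdegree e x + #|[set y | (y != x) && ~~ e x y]| = #|T|.-1.
Proof.
have -> : #|T|.-1 = #|[set~ x]| by rewrite cardsC1.
rewrite /rdegree -cardsUI [X in _ + X](_ : _ = 0) ?addn0; last first.
  apply/eqP; rewrite cards_eq0; apply/eqP/setP => y; rewrite !inE.
  by case: (e x y); rewrite ?andbF.
congr #|pred_of_set _|; apply/setP => y; rewrite !inE.
by case: eqP => [->|_]; rewrite ?ei //; case: (e x y).
Qed.

Lemma rdegree_lt (x : T) : rdegree e x < #|T|.
Proof. by have := card_nonadjacent x; lia. Qed.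

(** Take a non-adjacent pair of maximal degree sum, with smaller degree k. At least k vertices have
    degree at most k. If k = 2, two of them are the desired vertices; if k >= 3, the missing edges
    exceed what [big] allows. *)
Lemma two_degree2 : exists u v,
  [/\ u != v, rdegree e u = 2 & rdegree e v = 2].
Proof.
have : exists p : T * T, (p.1 != p.2) && ~~ e p.1 p.2.
  apply/existsP; apply: contra_notT nh => /existsPn h.
   apply: hamiltonian_complete => [|x y xy]; first by lia.
  by have := h (x, y); rewrite /= xy /= negbK.
case=> p0 p0P.
have := arg_maxnP (P := fun p : T * T => (p.1 != p.2) && ~~ e p.1 p.2)
  (fun p => rdegree e p.1 + rdegree e p.2) p0P.
case.
move=> [u0 v0] /= P0 max0.
have [u [v [uv nuv duv maxuv]]] : exists u v, [/\ u != v, ~~ e u v,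
    rdegree e u <= rdegree e v & forall x y, x != y -> ~~ e x y ->
    rdegree e x + rdegree e y <= rdegree e u + rdegree e v].
  case/andP: P0 => n0 e0.
  case: (leqP (rdegree e u0) (rdegree e v0)) => [le|/ltnW le].
    exists u0, v0; split=> // x y xy nxy; apply: (max0 (x, y)); exact/andP.
  exists v0, u0; rewrite eq_sym es addnC; split=> // x y xy nxy.
  by apply: (max0 (x, y)); exact/andP.
pose k := rdegree e u; pose n := #|T|.
have kn : k + rdegree e v < n by apply: closed.
have k2 : 2 <= k by apply: d2.
(* Maximality of the degree sum bounds the degrees in [S], the non-neighbours of [v], by [k], and
   those in [T0], the non-neighbours of [u], by the degree of [v], hence by n - 1 - k. *)
pose S := [set y | (y != v) && ~~ e v y].
pose T0 := [set y | (y != u) && ~~ e u y].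
have cS : rdegree e v + #|S| = n.-1 by apply: card_nonadjacent.
have cT0 : k + #|T0| = n.-1 by apply: card_nonadjacent.
have dS y : y \in S -> rdegree e y <= k.
  by rewrite inE => /andP[yv vy]; have := maxuv _ _ yv; rewrite es => /(_ vy); rewrite /k; lia.
have dT0 y : y \in T0 -> rdegree e y <= n - 1 - k.
  rewrite inE => /andP[yv vy]; have := maxuv _ _ yv; rewrite es => /(_ vy).
  by rewrite /k in kn *; lia.
have [kS k3] : k <= #|S| /\ (k = 2 \/ 3 <= k) by lia.
case: k3 => [k_eq2|k3].
  have : 1 < #|S| by lia.
  case/card_gt1P=> x [y [/dS xS /dS yS xy]]; exists x, y; split=> //.
    by have := d2 x; lia.
  by have := d2 y; lia.
(* [S] may have more than [k] elements; exactly [k] are kept, so that the count depends on n and k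
   only. *)
have [S' S'S cS'] : exists2 S' : {set T}, S' \subset S & #|S'| = k.
  case: (ltnP k #|S|) => h; last by exists S => //; lia.
  exists [set x in take k (enum S)].
    by apply/subsetP => x; rewrite inE => /mem_take; rewrite mem_enum.
  rewrite cardsE (card_uniqP _) ?take_uniq ?enum_uniq // size_take -cardE.
  by case: ltnP => //; lia.
(* [u] and [T0] make up n - k vertices of degree at most n - 1 - k; removing [S'] prevents double
   counting and leaves at least n - 2k. *)
pose U := (u |: T0) :\: S'.
have cU : n <= #|U| + k + k.
  have := cardsD (u |: T0) S'; have := subset_leq_card (subsetIr (u |: T0) S').
  by rewrite cardsU1 inE eqxx cS' /U /=; lia.
(* Vertices of S' have at least n - 1 - k non-neighbours, those of U at least k. *)
have sumd : \sum_x rdegree e x + (k * (n - 1 - k) + #|U| * k) <= n * (n - 1).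
  have -> : k * (n - 1 - k) = \sum_x (if x \in S' then n - 1 - k else 0).
    by rewrite -big_mkcond sum_nat_const cS'.
  have -> : #|U| * k = \sum_x (if x \in U then k else 0).
    by rewrite -big_mkcond sum_nat_const.
  have -> : n * (n - 1) = \sum_(x : T) (n - 1) by rewrite sum_nat_const.
  rewrite -!big_split /=.
  apply: leq_sum => x _; have dx := rdegree_lt x.
  rewrite !inE; case: ifP => [xS|_] /=.
    by have := dS _ (subsetP S'S _ xS); rewrite /n; lia.
  case: ifP => [|_]; last by rewrite /n; lia.
  case/orP=> [/eqP->|xT]; first by rewrite -/k; lia.
  by have := dT0 x; rewrite inE => /(_ xT); lia.
have kn2 : 2 * k + 1 <= n by lia.
have f : n * n + 11 + k * (n - 1 - k) + (n - k - k) * k <= n * (n - 1) + 5 * n.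
  have : (n - k - k) * k <= #|U| * k by rewrite leq_mul2r; lia.
  by move: big sumd; rewrite -/n; lia.
by case: (degree_sum_contra n14 k3 kn2 f).
Qed.

Lemma rdegreeD2 (u v x : T) : u != v -> rdegree e x =
  e x u + e x v + #|[set y | [&& y != u, y != v & e x y]]|.
Proof.
move=> uv; rewrite /rdegree (cardsD1 u) (cardsD1 v) !inE eq_sym uv addnA.
by congr (_ + #|pred_of_set _|); apply/setP => y; rewrite !inE andbCA.
Qed.

Lemma rdegree_le_off2 (u v x : T) : u != v -> x != u -> x != v ->
  rdegree e x <= #|T| - 3 + e x u + e x v.
Proof.
move=> uv xu xv; rewrite (rdegreeD2 x uv) addnC addnA leq_add2r leq_add2r.
have -> : #|T| - 3 = #|~: (x |: [set u; v])|.
  by rewrite -(cardsC (x |: [set u; v])) cardsU1 !inE negb_or xu xv cards2 uv addKn.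
apply/subset_leq_card/subsetP => y; rewrite !inE !negb_or.
by case: (y =P x) => [->|_] /and3P[-> ->]; rewrite ?ei.
Qed.

(** Otherwise closedness bounds the degree sum of [p] and [q] by n - 1. The total degree is then at
    most 4 + (n - 1) + (n - 4)(n - 3) + 4, which with [big] gives n <= 8. *)
Lemma clique_off_degree2 (u v p q : T) : rdegree e u = 2 -> rdegree e v = 2 ->
  u != v -> p != q -> p \notin [:: u; v] -> q \notin [:: u; v] -> e p q.
Proof.
move=> du dv uv pq; rewrite !inE !negb_or => /andP[pu pv] /andP[qu qv].
apply/negPn/negP => npq; have dpq := closed pq npq; move: big.
rewrite (bigD1 u) //= (bigD1 v) 1?eq_sym //= (bigD1 p) ?pu //= (bigD1 q) /=; last first.
  by rewrite qu qv eq_sym.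
rewrite du dv.
pose P i := (i != u) && (i != v) && (i != p) && (i != q).
set s := \sum_(i | P i) rdegree e i.
have cP : #|P| = #|T| - 4.
  rewrite -(cardC P).
  have -> : #|[predC P]| = size [:: u; v; p; q].
    rewrite -(card_uniqP _); last first.
      by rewrite /= !inE !negb_or uv pq (eq_sym u) pu (eq_sym u) qu (eq_sym v) pv (eq_sym v) qv.
    by apply: eq_card => y; rewrite !inE /P !negb_and !negbK -!orbA.
  by rewrite addnK.
(* Each remaining vertex has at most n - 3 neighbours besides [u] and [v]. The edges towards [u] and
   [v] are counted from their other end, where they number at most 4 in all. *)
have sle : s <= \sum_(x | P x) (#|T| - 3 + (e u x + e v x)).
  apply: leq_sum => x /andP[/andP[/andP[xu xv] _] _].
  by rewrite addnA (es u) (es v); apply: rdegree_le_off2.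
have sum2 z : \sum_(x | P x) e z x <= rdegree e z.
  rewrite /rdegree -sum1_card [leqRHS]big_mkcond /= [leqLHS]big_mkcond /=.
  by apply: leq_sum => x _; rewrite inE; case: (P x); case: (e z x).
move: sle; rewrite !big_split /= sum_nat_const cP.
have := sum2 u; have := sum2 v; rewrite du dv; move: dpq n14.
move: (\sum_(x | P x) e u x) (\sum_(x | P x) e v x) => A B; move: (#|T|) => n.
move=> dn nge cu cv cs cbig.
have [m mE] : exists m, n = m + 14 by exists (n - 14); lia.
have E3 : n - 3 = m + 11 by lia.
have E4 : n - 4 = m + 10 by lia.
rewrite E3 E4 mE in cs cbig dn; lia.
Qed.

(** The vertices other than [u] and [v] form a clique, and [u], [v] have the same neighbours in it.
    As both have degree 2, there is one such neighbour if [u] and [v] are adjacent and two if not;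
    these are the two shapes. *)
Lemma closed_structure : exists a b u v, uniq [:: a; b; u; v] /\
  (subrel e (split_join_rel a b u v) \/ subrel e (pendant_triangle_rel a u v)).
Proof.
have [u [v [uv du dv]]] := two_degree2.
have W p q := @clique_off_degree2 u v p q du dv uv.
(* A clique vertex [z] adjacent to [x] has degree at least (n - 3) + 1; with the 2 of [y] this
   reaches n, so closedness makes [z] and [y] adjacent. *)
have same (x y z : T) : (x = u /\ y = v) \/ (x = v /\ y = u) ->
  z \notin [:: u; v] -> e x z -> e y z.
  move=> xy zW xz; apply/negPn/negP => nyz.
  have zy : y != z.
    by apply: contraNneq zW => <-; rewrite !inE; case: xy => -[_ ->]; rewrite eqxx ?orbT.
  have := closed zy nyz; rewrite (rdegreeD2 z uv).
  have -> : rdegree e y = 2 by case: xy => -[_ ->].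
  have ez1 : 1 <= e z u + e z v.
    by case: xy => -[<- _]; rewrite (es z x) xz ?addn1 ?add1n.
  have : #|T| - 3 <= #|[set y | [&& y != u, y != v & e z y]]|.
    have -> : #|T| - 3 = #|~: (z |: [set u; v])|.
      rewrite -(cardsC (z |: [set u; v])) cardsU1 !inE.
      by move: (zW); rewrite !inE => ->; rewrite cards2 uv addKn.
    apply/subset_leq_card/subsetP => t; rewrite !inE !negb_or => /and3P[tz tu tv].
    by rewrite tu tv W // ?inE ?negb_or ?tu // eq_sym.
  lia.
have euv z : z \notin [:: u; v] -> e u z = e v z.
  by move=> zW; apply/idP/idP; apply: same => //; [left | right].
set N := [set y | [&& y != u, y != v & e u y]].
have cN : e u v + #|N| = 2 by rewrite -du (rdegreeD2 u uv) ei.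
have inN x y : e x y -> x \in [:: u; v] -> y \notin [:: u; v] -> y \in N.
  move=> xy xuv yW; have : e u y.
    by move: xuv xy; rewrite !inE => /orP[]/eqP->; rewrite // euv.
  by move: yW; rewrite !inE negb_or => /andP[-> ->].
case: (boolP (e u v)) cN => uve cN.
  have /cards1P[a aE] : #|N| == 1 by lia.
  have : a \in N by rewrite aE inE.
  rewrite inE => /and3P[au av ua].
  (* Any further vertex serves as [b]; the comparison of the two shapes later moves edges to it. *)
  have [b] : exists b, b \in ~: (a |: [set u; v]).
    apply/set0Pn; rewrite -card_gt0.
    have := cardsC (a |: [set u; v]); rewrite cardsU1 cards2; lia.
  rewrite !inE !negb_or => /and3P[ba bu bv].
  exists a, b, u, v; split.
    by rewrite /= !inE !negb_or uv au av bu bv (eq_sym a) ba.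
  right=> x y xy; rewrite /pendant_triangle_rel.
  have -> /= : x != y by apply: contraTneq xy => ->; rewrite ei.
  case: (boolP (x \in [:: u; v])) => xW; case: (boolP (y \in [:: u; v])) => yW; rewrite ?orbT //.
    by have := inN _ _ xy xW yW; rewrite aE inE => ->; rewrite orbT.
  by rewrite es in xy; have := inN _ _ xy yW xW; rewrite aE inE => ->.
have /cards2P[a [b [ab NE]]] : #|N| == 2 by lia.
have : a \in N by rewrite NE !inE eqxx.
have : b \in N by rewrite NE !inE eqxx orbT.
rewrite !inE => /and3P[bu bv _] /and3P[au av _].
exists a, b, u, v; split.
  by rewrite /= !inE !negb_or uv au av bu bv ab.
left=> x y xy; rewrite /split_join_rel.
have -> /= : x != y by apply: contraTneq xy => ->; rewrite ei.
case: (boolP (x \in [:: u; v])) => xW; case: (boolP (y \in [:: u; v])) => yW; rewrite ?orbT //.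
- by move: xW yW uve xy; rewrite !inE => /orP[]/eqP-> /orP[]/eqP->;
    rewrite ?ei ?(es v) // => /negPf->.
- by have := inN _ _ xy xW yW; rewrite NE !inE => ->; rewrite orbT.
by rewrite es in xy; have := inN _ _ xy yW xW; rewrite NE !inE => ->.
Qed.
End Closed.

(** The degree hypotheses survive the passage to the closure, and containment in one of the two
    shapes is inherited by the original graph. *)
Lemma nonhamiltonian_structure (T : finType) (e : rel T) :
  symmetric e -> irreflexive e -> ~ hamiltonian_rel e -> 14 <= #|T| ->
  (forall x, 2 <= rdegree e x) ->
  #|T| * #|T| + 11 <= \sum_x rdegree e x + 5 * #|T| ->
  exists a b u v, uniq [:: a; b; u; v] /\
  (subrel e (split_join_rel a b u v) \/ subrel e (pendant_triangle_rel a u v)).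
Proof.
move=> es ei nh n14 d2 big.
have [e' [es' ei' ee' nh' cl]] := ore_closure es ei nh.
have le x := rdegree_subrel x ee'.
have [|| a [b [u [v [U sub]]]]] := closed_structure es' ei' nh' cl _ n14.
- by move=> x; apply: leq_trans (le x).
- by apply: leq_trans big _; rewrite leq_add2r leq_sum.
exists a, b, u, v; split=> //.
by case: sub => sub; [left|right] => x y /ee'/sub.
Qed.

(** The successor map of a Hamilton cycle would inject the independent set [S] into its
    complement. *)
Lemma nonhamiltonian_independent (T : finType) (e : rel T) (S : {set T}) :
  {in S &, forall x y, ~~ e x y} -> #|T| < #|S| + #|S| -> ~ hamiltonian_rel e.
Proof.
move=> indep big [c [/and3P[_ cyc Uc] cov]].
have : #|next c @: S| <= #|~: S|.
  apply/subset_leq_card/subsetP => _ /imsetP[x xS ->]; rewrite inE.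
  by apply/negP => nS; have := indep _ _ xS nS; rewrite next_cycle.
rewrite card_imset; last exact: (can_inj (prev_next Uc)).
by have := cardsC S; lia.
Qed.

Import Order.TTheory GRing.Theory Num.Theory.
Local Open Scope ring_scope.

(** * Rayleigh quotients and Perron vectors *)

Section Spectral.
Import complex.
Local Open Scope complex_scope.
Local Open Scope sesquilinear_scope.

(** Over the complex numbers the real symmetric matrix is diagonalised by a unitary matrix. In the
    new coordinates the form is a sum of squared moduli weighted by eigenvalues, all real and at
    most [r]. *)
Lemma rayleigh_mx (R : realType) (n : nat) (A : 'M[R]_n) (r : R) (x : 'rV[R]_n) :
  A^T = A -> (forall a, eigenvalue A a -> a <= r) ->
  (x *m A *m x^T) 0 0 <= r * (x *m x^T) 0 0.
Proof.
move=> As ub; pose toC : {rmorphism R -> R[i]} := real_complex R.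
pose B := map_mx toC A; pose P := spectralmx B; pose d := spectral_diag B.
have Bsym : B \is symmetricmx.
  by apply/is_hermitianmxP; rewrite expr0 scale1r map_mx_id // /B map_trmx As.
have Breal : B \is a realmx.
  by apply/mxOverP => i j; rewrite mxE; apply/complex_realP; exists (A i j).
have Bn := symmetric_normalmx Bsym Breal.
have Bh := realsym_hermsym Bsym Breal.
have BE : B = invmx P *m diag_mx d *m P by apply/orthomx_spectralP.
have Pu : P \is unitarymx := spectral_unitarymx B.
have PE : invmx P = P^t* by apply: invmx_unitary.
have dle i : d 0 i <= toC r.
  have /mxOverP/(_ 0 i)/complex_realP[a aE] := hermitian_spectral_diag_real Bh.
  rewrite -/d in aE; rewrite aE lecR; apply: ub; rewrite -(eigenvalue_map toC) -/B.
  apply/eigenvalueP; exists (row i P).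
    rewrite {1}BE -row_mul !mulmxA mulmxV ?spectral_unit // mul1mx row_mul row_diag_mx.
    by rewrite -scalemxAl aE -rowE.
  apply/negP => /eqP P0; have := spectral_unit B; rewrite -/P -row_free_unit.
  move/row_freeP => [Q /(congr1 (row i))]; rewrite row_mul P0 mul0mx => /rowP/(_ i).
  by rewrite !mxE eqxx => /eqP; rewrite eq_sym oner_eq0.
pose y := map_mx toC x; pose z := y *m P^t*.
have yE : map_mx toC x^T = y^t*.
  by apply/matrixP => i j; rewrite !mxE; apply/esym/CrealP/complex_realP; exists (x j i).
have zE : z^t* = P *m y^t*.
  by rewrite /z trmx_mul map_mxM map_trmx trmxK -map_mx_comp (map_mx_id (@conjCK _)).
rewrite -lecR -[(_)%:C]/(toC _) -[(r * _)%:C]/(toC _) rmorphM /=.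
have toC00 (M : 'M[R]_1) : toC (M 0 0) = (map_mx toC M) 0 0 by rewrite mxE.
rewrite !toC00 !map_mxM yE -/B -/y.
have -> : y *m B *m y^t* = z *m diag_mx d *m z^t*.
  by rewrite zE /z BE PE !mulmxA.
have -> : y *m y^t* = z *m z^t*.
  by rewrite zE /z -PE -!mulmxA mulKmx ?spectral_unit.
rewrite mul_mx_diag; move: (z) => w; rewrite !mxE mulr_sumr; apply: ler_sum => j _.
rewrite !mxE mulrAC [leLHS]mulrC; apply: ler_wpM2r; last exact: dle.
exact: mul_conjC_ge0.
Qed.
End Spectral.

(** * Eigenvectors and Rayleigh quotients as functions on the vertices *)

Lemma sum_enum_val (V : nmodType) (T : finType) (F : T -> V) :
  \sum_(i < #|T|) F (enum_val i) = \sum_x F x.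
Proof.
rewrite (reindex (@enum_rank T)); last exact/onW_bij/enum_rank_bij.
by apply: eq_bigr => x _; rewrite enum_rankK.
Qed.

Lemma adjacency_eigenvalueP (R : realType) (G : sgraph) (a : R) :
  eigenvalue (adjacency G R) a <->
  exists2 x : G -> R, (exists v, x v != 0) &
    forall v, \sum_(w | edge v w) x w = a * x v.
Proof.
split.
  case/eigenvalueP=> x /rowP xA /rV0Pn[j xj].
  exists (fun w => x 0 (enum_rank w)); first by exists (enum_val j); rewrite enum_valK.
  move=> v; have := xA (enum_rank v); rewrite !mxE => <-.
  rewrite big_mkcond /=.
  rewrite -(sum_enum_val (fun w => if edge v w then x 0 (enum_rank w) else 0)).
  apply: eq_bigr => i _; rewrite !mxE enum_rankK enum_valK edge_sym.
  by case: (edge _ _); rewrite ?mulr1 ?mulr0.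
case=> x [v xv] xA; apply/eigenvalueP; exists (\row_i x (enum_val i)).
  apply/rowP => j; rewrite !mxE -xA [RHS]big_mkcond /= -[RHS]sum_enum_val.
  apply: eq_bigr => i _; rewrite !mxE edge_sym.
  by case: (edge _ _); rewrite ?mulr1 ?mulr0.
by apply/rV0Pn; exists (enum_rank v); rewrite mxE enum_rankK.
Qed.

Section SpectralRadius.
Variables (R : realType) (G : sgraph).
Hypothesis G0 : (0 < #|G|)%N.
Let rho := spectral_radius R G.

Lemma rayleigh (x : G -> R) :
  \sum_v x v * \sum_(w | edge v w) x w <= rho * \sum_v x v ^+ 2.
Proof.
have As : (adjacency G R)^T = adjacency G R.
  by apply/matrixP => i j; rewrite !mxE edge_sym.
have := rayleigh_mx (\row_i x (enum_val i)) As (spectral_radius_max R G0).2.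
rewrite !mxE -/rho.
rewrite -(sum_enum_val (fun v => x v * \sum_(w | edge v w) x w)).
rewrite -(sum_enum_val (fun v => x v ^+ 2)).
set a := \sum_i _; set b := \sum_i _; set c := \sum_i _; set d := \sum_i _.
have -> : b = d by apply: eq_bigr => i _; rewrite !mxE expr2.
suff -> : a = c by [].
apply: eq_bigr => i _; rewrite !mxE mulrC; congr (_ * _).
rewrite [RHS]big_mkcond /= -[RHS]sum_enum_val.
apply: eq_bigr => j _; rewrite !mxE edge_sym.
by case: (edge _ _); rewrite ?mulr1 ?mulr0.
Qed.

(** A vector attaining the maximal quotient is an eigenvector: were its residual nonzero, a small
    move along the residual would raise the quotient above [rho]. *)
Lemma rayleigh_eq (x : G -> R) :
  rho * \sum_v x v ^+ 2 <= \sum_v x v * \sum_(w | edge v w) x w ->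
  forall v, \sum_(w | edge v w) x w = rho * x v.
Proof.
move=> xeq.
pose A (y : G -> R) v := \sum_(w | edge v w) y w.
pose r v := A x v - rho * x v.
have Asym y z : \sum_v y v * A z v = \sum_v z v * A y v.
  rewrite /A; under eq_bigr do rewrite mulr_sumr.
  under [RHS]eq_bigr do rewrite mulr_sumr.
  rewrite (exchange_big_dep predT) //=; apply: eq_bigr => v _.
  by apply: eq_big => w; rewrite 1?edge_sym // mulrC.
(* Maximality of the quotient at [x] along the direction of the residual [r]. *)
pose nr := \sum_v r v ^+ 2; pose q := \sum_v r v * A r v - rho * nr.
have main t : 0 <= t -> 2 * t * nr + t ^+ 2 * q <= 0.
  move=> t0; have := rayleigh (fun v => x v + t * r v).
  have -> : \sum_v (x v + t * r v) * \sum_(w | edge v w) (x w + t * r w) =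
     \sum_v x v * A x v + 2 * t * (\sum_v r v * A x v) + t ^+ 2 * \sum_v r v * A r v.
    have AE v : \sum_(w | edge v w) (x w + t * r w) = A x v + t * A r v.
      by rewrite big_split /= mulr_sumr.
    under eq_bigr do rewrite AE.
    transitivity (\sum_v x v * A x v + t * (\sum_v r v * A x v) +
       (t * \sum_v x v * A r v) + t ^+ 2 * \sum_v r v * A r v).
      by rewrite !mulr_sumr -!big_split /=; apply: eq_bigr => v _; ring.
    by rewrite (Asym x r); ring.
  have -> : \sum_v (x v + t * r v) ^+ 2 =
     \sum_v x v ^+ 2 + 2 * t * \sum_v r v * x v + t ^+ 2 * nr.
    by rewrite !mulr_sumr -!big_split /=; apply: eq_bigr => v _; ring.
  have : nr = \sum_v r v * A x v - rho * \sum_v r v * x v.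
    by rewrite mulr_sumr -sumrB; apply: eq_bigr => v _; rewrite /r; ring.
  rewrite /q; move: xeq; rewrite -/(A x _).
  under eq_bigr do rewrite -/(A x _).
  move=> xeq nrE h; rewrite {1}nrE; lra.
have nr0 : nr <= 0.
  rewrite leNgt; apply/negP => nrp.
  have d0 : 0 < nr + `|q| by rewrite ltr_wpDr.
  (* This t satisfies t|q| = nr - t nr < nr, so 2 nr + t q remains positive and contradicts
     [main]. *)
  have := main (nr / (nr + `|q|)).
  rewrite divr_ge0 ?(ltW nrp) ?(ltW d0) // => /(_ isT).
  have := ler_norm (- q); rewrite normrN => hq.
  set t := nr / _; have t0 : 0 < t by rewrite divr_gt0.
  have tE : t * (nr + `|q|) = nr by rewrite divfK ?gt_eqF.
  have : 0 < t * (2 * nr + t * q); last first.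
    by rewrite (_ : _ * _ = 2 * t * nr + t ^+ 2 * q); [move=> *; lra|ring].
  rewrite mulr_gt0 //; have : t * - q <= t * `|q| by rewrite ler_pM2l.
  have : 0 < t * nr by rewrite mulr_gt0.
  lra.
move=> v; apply/eqP; rewrite -subr_eq0 -/(A x v) -/(r v) -sqrf_eq0.
have : nr == 0 by rewrite eq_le nr0 sumr_ge0 // => w _; rewrite sqr_ge0.
by rewrite psumr_eq0 => [/allP/(_ v)|w _]; rewrite ?sqr_ge0 // mem_index_enum => /(_ isT).
Qed.

(** Replacing the entries of a top eigenvector by their absolute values keeps the norm and does not
    lower the quadratic form, so [rayleigh_eq] applies. *)
Lemma perron : exists x : G -> R, [/\ forall v, 0 <= x v, exists v, 0 < x v &
  forall v, \sum_(w | edge v w) x w = rho * x v].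
Proof.
have [/adjacency_eigenvalueP[x [v0 xv0] xA] _] := spectral_radius_max R G0.
exists (fun v => `|x v|); split=> [v||]; first exact: normr_ge0.
  by exists v0; rewrite normr_gt0.
apply: rayleigh_eq.
have -> : rho * \sum_v `|x v| ^+ 2 = \sum_v x v * \sum_(w | edge v w) x w.
  rewrite mulr_sumr; apply: eq_bigr => v _.
  by rewrite xA real_normK ?num_real // -/rho; ring.
apply: ler_sum => v _; apply: le_trans (ler_norm _) _; rewrite normrM.
by apply: ler_wpM2l => //; apply: ler_norm_sum.
Qed.

Lemma spectral_radius_ge (t : R) (x : G -> R) : (exists v, x v != 0) ->
  t * \sum_v x v ^+ 2 < \sum_v x v * \sum_(w | edge v w) x w -> t < rho.
Proof.
move=> [v xv] h; have := lt_le_trans h (rayleigh x); rewrite ltr_pM2r //.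
rewrite (bigD1 v) //= ltr_wpDr ?sumr_ge0 // => [w _|]; first exact: sqr_ge0.
by rewrite exprn_even_gt0.
Qed.

(** Collatz-Wielandt bound: pairing [y] with a Perron vector x gives rho <x, y> = <x, Ay> <= t <x,
    y>, and <x, y> is positive. *)
Lemma spectral_radius_le (t : R) (y : G -> R) : (forall v, 0 < y v) ->
  (forall v, \sum_(w | edge v w) y w <= t * y v) -> rho <= t.
Proof.
move=> y0 Ay; have [x [x0 [v0 xv0] xA]] := perron.
have s0 : 0 < \sum_v x v * y v.
  rewrite (bigD1 v0) //= ltr_wpDr ?sumr_ge0 ?mulr_gt0 // => w _.
  by rewrite mulr_ge0 // ltW.
rewrite -(ler_pM2r s0) !mulr_sumr.
have -> : \sum_v rho * (x v * y v) = \sum_v x v * \sum_(w | edge v w) y w.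
  under eq_bigr do rewrite mulrA -xA mulr_suml.
  under [RHS]eq_bigr do rewrite mulr_sumr.
  rewrite (exchange_big_dep predT) //=; apply: eq_bigr => v _.
  by apply: eq_big => w; rewrite 1?edge_sym.
by apply: ler_sum => v _; rewrite mulrCA; apply: ler_wpM2l.
Qed.

End SpectralRadius.

Lemma spectral_radius_iso (R : realType) (G H : sgraph) :
  isomorphic G H -> spectral_radius R G = spectral_radius R H.
Proof.
case=> f [[g fK gK] fe]; congr sup; apply/classical_sets.seteqP; split=> a /=.
  case/adjacency_eigenvalueP=> x [v xv] xA; apply/adjacency_eigenvalueP.
  exists (x \o g); first by exists (f v); rewrite /= fK.
  move=> v' /=; rewrite -xA (reindex f); last by exists g => w _.
  by apply: eq_big => [w|w _] /=; rewrite ?fK // -{1}(gK v') fe.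
case/adjacency_eigenvalueP=> x [v xv] xA; apply/adjacency_eigenvalueP.
exists (x \o f); first by exists (g v); rewrite /= gK.
move=> v' /=; rewrite -xA (reindex f (P := edge (f v'))); last by exists g => w _.
by apply: eq_big => [w|w _] //=; rewrite fe.
Qed.

(** * Extremal graphs *)

(** Besides [w] and its neighbours there are n - 1 - d(w) vertices, each of degree at least 2. In
    effect this bounds the row sum of A^2 - A at [w]. *)
Lemma degree_sum_nbr (G : sgraph) (w : G) : (forall v : G, (2 <= degree v)%N) ->
  (\sum_(v | edge w v) degree v + 2 * #|G|.-1 <= \sum_(v : G) degree v + degree w)%N.
Proof.
move=> d2; rewrite (bigID (edge w) predT) /= -addnA leq_add2l (bigD1 w) ?edge_irrefl //=.
have : (2 * #|[set v | ~~ edge w v && (v != w)]| <= \sum_(v | ~~ edge w v && (v != w)) degree v)%N.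
  by rewrite mulnC -sum_nat_cond_const; apply: leq_sum.
have h : (degree w + #|[set v | ~~ edge w v && (v != w)]| = #|G|.-1)%N.
  rewrite -(card_nonadjacent (@edge_irrefl G) w); congr (_ + #|pred_of_set _|)%N.
  by apply/setP => v; rewrite !inE andbC.
by rewrite -h; lia.
Qed.

Lemma spectral_radius_degree_bound (R : realType) (G : sgraph) :
  (0 < #|G|)%N -> (forall v : G, (2 <= degree v)%N) ->
  spectral_radius R G ^+ 2 - spectral_radius R G <=
    (\sum_(v : G) degree v)%:R - 2 * (#|G|%:R - 1).
Proof.
move=> G0 d2; set r := spectral_radius R G; have [x [x0 [v0 xv0] xA]] := perron R G0.
have S0 : 0 < \sum_v x v.
  by rewrite (bigD1 v0) //= ltr_wpDr // sumr_ge0.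
have swap (c : G -> R) : \sum_v c v * \sum_(w | edge v w) x w =
    \sum_w (\sum_(v | edge w v) c v) * x w.
  under eq_bigr do rewrite mulr_sumr.
  under [RHS]eq_bigr do rewrite mulr_suml.
  rewrite (exchange_big_dep predT) //=; apply: eq_bigr => v _.
  by apply: eq_bigl => w; rewrite edge_sym.
(* [E1] and [E2] sum the entries of Ax and A^2 x, so that the row sums of A and A^2 become the
   coefficients of x. *)
have E1 : r * \sum_v x v = \sum_v (degree v)%:R * x v.
  rewrite mulr_sumr; under eq_bigr do rewrite -xA -(mul1r (\sum_(_ | _) _)).
  rewrite swap; apply: eq_bigr => w _; congr (_ * _).
  by rewrite /degree -sum1_card natr_sum; apply: eq_bigl => v; rewrite inE.
have E2 : r ^+ 2 * \sum_v x v = \sum_w (\sum_(v | edge w v) (degree v)%:R) * x w.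
  rewrite -swap expr2 -mulrA E1 mulr_sumr; apply: eq_bigr => v _.
  by rewrite xA mulrCA.
rewrite -(ler_pM2r S0) mulrBl E1 E2 -sumrB mulr_sumr.
apply: ler_sum => w _; rewrite -mulrBl; apply: ler_wpM2r => //.
rewrite -natr_sum; have := degree_sum_nbr w d2.
rewrite mul2n -addnn -(ler_nat R) !natrD -subn1 natrB //; lra.
Qed.

(** * Weights on joins and disjoint unions *)

Section SumTypes.
Variables (R : realType) (G1 G2 : sgraph).

Lemma big_join (F : graph_join G1 G2 -> R) :
  \sum_v F v = \sum_v F (inl v) + \sum_v F (inr v).
Proof. exact: big_sumType. Qed.

Lemma big_union (F : disjoint_union G1 G2 -> R) :
  \sum_v F v = \sum_v F (inl v) + \sum_v F (inr v).
Proof. exact: big_sumType. Qed.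

Lemma nbr_join_l (F : graph_join G1 G2 -> R) (v : G1) :
  \sum_(w : graph_join G1 G2 | edge (inl v : graph_join G1 G2) w) F w =
  \sum_(w | edge v w) F (inl w) + \sum_w F (inr w).
Proof. exact: big_sumType. Qed.

Lemma nbr_join_r (F : graph_join G1 G2 -> R) (v : G2) :
  \sum_(w : graph_join G1 G2 | edge (inr v : graph_join G1 G2) w) F w =
  \sum_w F (inl w) + \sum_(w | edge v w) F (inr w).
Proof. exact: big_sumType. Qed.

Lemma nbr_union_l (F : disjoint_union G1 G2 -> R) (v : G1) :
  \sum_(w : disjoint_union G1 G2 | edge (inl v : disjoint_union G1 G2) w) F w =
  \sum_(w | edge v w) F (inl w).
Proof. by rewrite big_sumType /= [X in _ + X]big_pred0 // addr0. Qed.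

Lemma nbr_union_r (F : disjoint_union G1 G2 -> R) (v : G2) :
  \sum_(w : disjoint_union G1 G2 | edge (inr v : disjoint_union G1 G2) w) F w =
  \sum_(w | edge v w) F (inr w).
Proof. by rewrite big_sumType /= [X in X + _]big_pred0 // add0r. Qed.

End SumTypes.

Lemma nbr_complete (R : realType) (n : nat) (c : R) (v : complete_graph n) :
  \sum_(w | edge v w) c = (n.-1)%:R * c.
Proof.
rewrite sumr_const mulr_natl; congr (_ *+ _).
by rewrite -[n in n.-1]card_ord -(cardC1 v); apply: eq_card => w; rewrite !inE eq_sym.
Qed.

Lemma nbr_copies1 (R : realType) (k : nat) (F : copies k (complete_graph 1) -> R)
    (v : copies k (complete_graph 1)) :
  \sum_(w | edge v w) F w = 0.
Proof.
by apply: big_pred0 => w; rewrite /= /copies_rel /= /complete_rel !ord1 eqxx andbF.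
Qed.

Lemma sum_complete (R : realType) (n : nat) (c : R) :
  \sum_(w : complete_graph n) c = n%:R * c.
Proof. by rewrite sumr_const card_ord mulr_natl. Qed.

Lemma sum_copies1 (R : realType) (k : nat) (c : R) :
  \sum_(w : copies k (complete_graph 1)) c = k%:R * c.
Proof. by rewrite sumr_const card_prod !card_ord muln1 mulr_natl. Qed.

Definition G2_weight (R : realType) (n : nat) (a b c : R) (v : G2 n) : R :=
  match v with inl _ => a | inr (inl _) => b | inr (inr _) => c end.

(** The three cells form an equitable partition, so the adjacency operator acts on weights constant
    on cells through a 3 by 3 quotient matrix. *)
Lemma nbr_G2_weight (R : realType) (n : nat) (a b c : R) (v : G2 n) :
  \sum_(w | edge v w) G2_weight a b c w =
  G2_weight (a + ((n - 4)%:R * b + 2 * c)) (2 * a + ((n - 4).-1)%:R * b) (2 * a) v.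
Proof.
case: v => [v|[v|v]]; rewrite ?nbr_join_l ?nbr_join_r.
- by rewrite big_union /= nbr_complete mul1r sum_complete sum_copies1.
- by rewrite nbr_union_l /= nbr_complete sum_complete.
- by rewrite nbr_union_r /= nbr_copies1 addr0 sum_complete.
Qed.

Lemma card_G2 (n : nat) : (4 <= n)%N -> #|G2 n| = n.
Proof. by move=> n4; rewrite /= !card_sum card_prod !card_ord; lia. Qed.

Lemma spectral_radius_G2_gt (R : realType) (n : nat) : (5 <= n)%N ->
  n%:R - 3 < spectral_radius R (G2 n).
Proof.
move=> n5; have G0 : (0 < #|G2 n|)%N by rewrite card_G2; lia.
pose m : R := n%:R - 3.
have m0 : 2 <= m by rewrite /m lerBrDr -natrD ler_nat.
(* Weight 1 on the clique of n - 2 vertices alone gives the quotient m = n - 3. Weight [c] on the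
   two other vertices adds 8c to the form through their four edges, against m * 2c^2 = 2c from the
   norm. *)
pose c : R := m^-1.
have cE : m * c = 1 by rewrite mulfV // gt_eqF //; lra.
have c0 : 0 < c by rewrite invr_gt0; lra.
apply: (spectral_radius_ge G0 (x := G2_weight 1 1 c)).
  by exists (inl ord0); rewrite /= oner_eq0.
under [X in _ < X]eq_bigr do rewrite nbr_G2_weight.
rewrite !big_sumType /= !sum_complete !sum_copies1.
have -> : (n - 4)%:R = m - 1 :> R by rewrite natrB; [rewrite /m; lra|lia].
have -> : (n - 4).-1%:R = m - 2 :> R by rewrite -subn1 !natrB; [rewrite /m; lra|lia|lia].
rewrite -/m; have : m * c * c = c by rewrite cE mul1r.
nra.
Qed.

Lemma spectral_radius_G2_le (R : realType) (n m : nat) (t a b c : R) :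
  (n - 4 = m)%N -> 0 < a -> 0 < b -> 0 < c ->
  a + (m%:R * b + 2 * c) <= t * a ->
  2 * a + m.-1%:R * b <= t * b -> 2 * a <= t * c ->
  spectral_radius R (G2 n) <= t.
Proof.
move=> nm a0 b0 c0 ha hb hc.
have G0 : (0 < #|G2 n|)%N by apply/card_gt0P; exists (inl ord0).
apply: (spectral_radius_le G0 (y := G2_weight a b c)); first by case=> [|[]].
by move=> v; rewrite nbr_G2_weight nm; case: v => [|[]].
Qed.

Lemma spectral_radius_join_gt (R : realType) (k m : nat) (t a b : R) :
  (0 < k)%N -> a != 0 ->
  t * (k%:R * a ^+ 2 + m%:R * b ^+ 2) <
    k%:R * (a * (k.-1%:R * a + m%:R * b)) + m%:R * (b * (k%:R * a)) ->
  t < spectral_radius R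
        (graph_join (complete_graph k) (copies m (complete_graph 1))).
Proof.
set G := graph_join _ _ => k0 a0 h.
have G0 : (0 < #|G|)%N by rewrite /= card_sum card_ord; lia.
apply: (spectral_radius_ge G0
  (x := fun v : G => match v with inl _ => a | inr _ => b end)).
  by exists (inl (Ordinal k0)).
rewrite !big_join.
under [X in _ < X + _]eq_bigr do rewrite nbr_join_l /= nbr_complete sum_copies1.
under [X in _ < _ + X]eq_bigr do rewrite nbr_join_r /= nbr_copies1 addr0 sum_complete.
by rewrite /= !sum_complete !sum_copies1.
Qed.

(** The [m] copies of a single vertex are independent and outnumber the other [k] vertices. *)
Lemma join_nonhamiltonian (k m : nat) : (k < m)%N ->
  ~ hamiltonian (graph_join (complete_graph k) (copies m (complete_graph 1))).
Proof.
move=> km; set G := graph_join _ _.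
apply: (@nonhamiltonian_independent G edge [set inr v | v : copies m (complete_graph 1)]).
  move=> _ _ /imsetP[v _ ->] /imsetP[w _ ->] /=.
  by rewrite /copies_rel /= /complete_rel !ord1 eqxx andbF.
rewrite card_imset; last by move=> ? ? [].
by rewrite /= !card_sum !card_prod !card_ord; lia.
Qed.

(** * Comparison of the two shapes and of their subgraphs *)

Lemma split_join_sym (T : eqType) (a b u v : T) : symmetric (split_join_rel a b u v).
Proof. by move=> x y; rewrite /split_join_rel eq_sym orbCA [(_ \notin _) && _]andbC. Qed.

Lemma split_join_irrefl (T : eqType) (a b u v : T) : irreflexive (split_join_rel a b u v).
Proof. by move=> x; rewrite /split_join_rel eqxx. Qed.

Lemma pendant_triangle_sym (T : eqType) (a u v : T) :
  symmetric (pendant_triangle_rel a u v).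
Proof.
by move=> x y; rewrite /pendant_triangle_rel eq_sym orbCA addbC.
Qed.

Lemma pendant_triangle_irrefl (T : eqType) (a u v : T) :
  irreflexive (pendant_triangle_rel a u v).
Proof. by move=> x; rewrite /pendant_triangle_rel eqxx. Qed.

Definition split_join (T : finType) (a b u v : T) : sgraph :=
  SGraph (split_join_sym a b u v) (split_join_irrefl a b u v).

Definition pendant_triangle (T : finType) (a u v : T) : sgraph :=
  SGraph (pendant_triangle_sym a u v) (pendant_triangle_irrefl a u v).

Lemma isomorphic_sym (G H : sgraph) : isomorphic G H -> isomorphic H G.
Proof.
case=> f [[g fK gK] fe]; exists g; split; first by exists f.
by move=> x y; rewrite -fe !gK.
Qed.

Lemma split_join_iso (T : finType) (a b u v : T) :
  uniq [:: a; b; u; v] -> isomorphic (split_join a b u v) (G2 #|T|).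
Proof.
move=> U; apply: isomorphic_sym; set n := #|T|.
pose rest := enum (~: [set x in [:: a; b; u; v]]).
have n4 : (4 <= n)%N.
  by rewrite -[4%N]/(size [:: a; b; u; v]) -(card_uniqP U) max_card.
have szr : size rest = (n - 4)%N.
  have c4 : #|[set x in [:: a; b; u; v]]| = 4 by rewrite cardsE (card_uniqP U).
  by rewrite /rest -cardE /n -(cardsC [set x in [:: a; b; u; v]]) c4; lia.
have Ur : uniq rest by apply: enum_uniq.
pose g (s : G2 n) : T := match s with
  | inl i => nth a [:: a; b] i
  | inr (inl j) => nth a rest j
  | inr (inr p) => nth a [:: u; v] p.1 end.
(* Adjacency on both sides depends only on equality and on membership in the first and last cells,
   which [top] and [bot] record. *)
pose top (s : G2 n) := if s is inl _ then true else false.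
pose bot (s : G2 n) := if s is inr (inr _) then true else false.
have restP (j : 'I_(n - 4)) : (nth a rest j \notin [:: a; b]) && (nth a rest j \notin [:: u; v]).
  have : nth a rest j \in rest by rewrite mem_nth // szr.
  by rewrite mem_enum !inE -negb_or -!orbA.
have ab_uv x : x \in [:: a; b] -> x \notin [:: u; v].
  move: U; rewrite -[[:: a; b; u; v]]/([:: a; b] ++ [:: u; v]) cat_uniq.
  by case/and3P=> _ /hasPn h _ xab; apply: contraTN xab => /h.
have gtop s : (g s \in [:: a; b]) = top s.
  case: s => [i|[j|[i k]]] /=; first by rewrite mem_nth.
    by have /andP[/negPf->] := restP j.
  apply/negP => /ab_uv; rewrite mem_nth //.
have gbot s : (g s \in [:: u; v]) = bot s.
  case: s => [i|[j|[i k]]] /=; last by rewrite mem_nth.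
    by apply/negbTE; apply: ab_uv; apply: mem_nth.
  by have /andP[_ /negPf->] := restP j.
have ginj : injective g.
  have [Uab Uuv] : uniq [:: a; b] /\ uniq [:: u; v].
    by move: U; rewrite -[[:: a; b; u; v]]/([:: a; b] ++ [:: u; v]) cat_uniq => /and3P[].
  move=> s t gst; have : top s = top t by rewrite -!gtop gst.
  have : bot s = bot t by rewrite -!gbot gst.
  case: s t gst => [i|[j|[i k]]] [i'|[j'|[i' k']]] //= /eqP; rewrite nth_uniq ?szr //.
  - by move=> /eqP/val_inj->.
  - by move=> /eqP/val_inj->.
  - by move=> /eqP/val_inj-> _ _; rewrite (ord1 k) (ord1 k').
exists g; split; first by apply: inj_card_bij => //; rewrite card_G2.
move=> s t; rewrite /= /split_join_rel (inj_eq ginj) !gtop !gbot.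
case: s t => [i|[j|[i k]]] [i'|[j'|[i' k']]] //=; rewrite ?andbT ?andbF //.
by rewrite /copies_rel /= /complete_rel (ord1 k) (ord1 k') eqxx andbF.
Qed.

(** The eigenvalue equation spreads positivity along edges: from one positive entry to [c], and from
    [c] to every vertex. *)
Lemma dominated_eigenvector_gt0 (R : realType) (G : sgraph) (c : G) (r : R)
    (x : G -> R) :
  (forall w, w != c -> edge c w) -> 0 < r -> (forall v, 0 <= x v) ->
  (exists v, 0 < x v) -> (forall v, \sum_(w | edge v w) x w = r * x v) ->
  forall v, 0 < x v.
Proof.
move=> dom r0 x0 [v0 xv0] xA.
have nbr_gt0 v w : edge v w -> 0 < x w -> 0 < x v.
  move=> vw xw; rewrite -(pmulr_rgt0 _ r0) -xA (bigD1 w) //= ltr_wpDr //.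
  by rewrite sumr_ge0.
have xc : 0 < x c by have [<- //|v0c] := eqVneq v0 c; apply: nbr_gt0 xv0; apply: dom.
move=> v; have [->//|vc] := eqVneq v c.
by apply: nbr_gt0 xc; rewrite edge_sym; apply: dom.
Qed.

Lemma subgraph_quadratic_le (R : realType) (T : finType) (e e' : rel T) (x : T -> R) :
  subrel e e' -> (forall v, 0 <= x v) ->
  forall v, \sum_(w | e v w) x w <= \sum_(w | e' v w) x w.
Proof.
move=> ee x0 v; rewrite [leLHS]big_mkcond [leRHS]big_mkcond; apply: ler_sum => w _.
by case: ifP => [/ee->//|_]; case: ifP.
Qed.

(** A Perron vector of [G] also attains the maximal quotient of the larger graph, hence is an
    eigenvector there and positive everywhere. An additional edge would then raise the quotient
    strictly. *)
Lemma spectral_radius_subgraph_eq (R : realType) (G : sgraph) (e : rel G)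
    (es : symmetric e) (ei : irreflexive e) (c : G) :
  (forall w, w != c -> e c w) -> subrel (@edge G) e ->
  0 < spectral_radius R (SGraph es ei) ->
  spectral_radius R (SGraph es ei) <= spectral_radius R G ->
  forall s t, edge s t = e s t.
Proof.
set H := SGraph es ei => dom sub rH0 le s t.
have G0 : (0 < #|G|)%N by apply/card_gt0P; exists c.
have [x [x0 xpos xA]] := perron R G0.
have x2 : 0 <= \sum_v x v ^+ 2 by apply: sumr_ge0 => v _; apply: sqr_ge0.
have GE : \sum_v x v * \sum_(w | edge v w) x w = spectral_radius R G * \sum_v x v ^+ 2.
  by rewrite mulr_sumr; apply: eq_bigr => v _; rewrite xA; ring.
have leGH v : \sum_(w | edge v w) x w <= \sum_(w | e v w) x w.
  exact: subgraph_quadratic_le.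
have GH : \sum_v x v * \sum_(w | edge v w) x w <= \sum_v x v * \sum_(w | e v w) x w.
  by apply: ler_sum => v _; apply: ler_wpM2l.
have HG : \sum_v x v * \sum_(w | e v w) x w <= spectral_radius R G * \sum_v x v ^+ 2.
  by apply: le_trans (@rayleigh R H G0 x) _; apply: ler_wpM2r.
have xH : forall v : H, \sum_(w | edge v w) x w = spectral_radius R H * x v.
  apply: rayleigh_eq => //; apply: le_trans GH; rewrite GE.
  exact: ler_wpM2r.
have xgt0 : forall v : H, 0 < x v.
  exact: (@dominated_eigenvector_gt0 R H c _ x dom rH0 x0 xpos xH).
apply/idP/idP => [/sub//|est]; apply: contraT => nst.
have : \sum_v x v * \sum_(w | edge v w) x w < \sum_v x v * \sum_(w | e v w) x w.
  rewrite (bigD1 s) //= [ltRHS](bigD1 s) //=; apply: ltr_leD; last first.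
    by apply: ler_sum => v _; apply: ler_wpM2l.
  rewrite ltr_pM2l ?xgt0 // [ltRHS](bigD1 t) //= ltr_pwDl ?xgt0 //.
  rewrite [leLHS]big_mkcond [leRHS]big_mkcond; apply: ler_sum => w _.
  case: ifP => [sw|_]; last by case: ifP.
  by rewrite (sub _ _ sw) /=; case: eqP => // wt; rewrite -wt sw in nst.
by rewrite GE ltNge HG.
Qed.

Lemma spectral_radius_subgraph_le (R : realType) (G : sgraph) (e : rel G)
    (es : symmetric e) (ei : irreflexive e) :
  (0 < #|G|)%N -> subrel (@edge G) e ->
  spectral_radius R G <= spectral_radius R (SGraph es ei).
Proof.
set H := SGraph es ei => G0 sub.
have [x [x0 [v xv] xA]] := perron R G0.
have x2 : 0 < \sum_v x v ^+ 2.
  by rewrite (bigD1 v) //= ltr_wpDr ?exprn_gt0 // sumr_ge0 // => w _; apply: sqr_ge0.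
rewrite -(ler_pM2r x2); apply: le_trans (@rayleigh R H G0 x).
rewrite mulr_sumr; apply: ler_sum => w _; rewrite expr2 mulrCA -xA.
by apply: ler_wpM2l => //; apply: subgraph_quadratic_le.
Qed.

(** Extracts the contribution of one ordered pair, for the bookkeeping when edges are exchanged. *)
Lemma big_delta2 (R : realType) (T : finType) (s t : T) (F : T -> T -> R) :
  \sum_y \sum_z ((y == s) && (z == t))%:R * F y z = F s t.
Proof.
rewrite (bigD1 s) //= (bigD1 t) //= !eqxx mul1r !big1 ?addr0 // => [y /negPf->|z /negPf->].
  by rewrite big1 // => z _; rewrite mul0r.
by rewrite mul0r.
Qed.

Lemma quadratic_mkcond (R : realType) (T : finType) (e : rel T) (x : T -> R) :
  \sum_y x y * \sum_(z | e y z) x z = \sum_y \sum_z (e y z)%:R * (x y * x z).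
Proof.
apply: eq_bigr => y _; rewrite mulr_sumr big_mkcond; apply: eq_bigr => z _.
by case: (e y z); rewrite ?mul1r ?mul0r.
Qed.

(** Replacing the edge uv by ub and vb turns the first graph into the second. On a Perron vector of
    the first this changes the form by 2 x_b (x_u + x_v) - 2 x_u x_v, which is positive once x_b >=
    x_u = x_v. The vertex [b'] is a twin of [b], used to bound x_b from below. *)
Lemma pendant_triangle_lt (R : realType) (T : finType) (a b u v b' : T) :
  uniq [:: a; b; u; v; b'] -> 1 < spectral_radius R (split_join a b u v) ->
  spectral_radius R (pendant_triangle a u v) < spectral_radius R (split_join a b u v).
Proof.
set H := pendant_triangle a u v; set S := split_join a b u v => U r1.
rewrite ltNge; apply/negP => le.
have G0 : (0 < #|T|)%N by apply/card_gt0P; exists a.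
have [x [x0 xpos xA]] := @perron R H G0.
move: U; rewrite /= !inE !negb_or.
case/and4P=> /and4P[ab au av ab'] /and3P[bu bv bb'] /andP[uv ub'] /andP[vb' _].
set r := spectral_radius R H in le xA.
have {}r1 : 1 < r by apply: lt_le_trans le.
have r0 : 0 < r by lra.
have xgt0 : forall w, 0 < x w.
  apply: (@dominated_eigenvector_gt0 R H a r x) => // w wa /=.
  by rewrite /pendant_triangle_rel eq_sym wa eqxx.
have two (s t : T) : s != t -> x s + x t = \sum_(w | (w == s) || (w == t)) x w.
  move=> st; rewrite (bigD1 s) ?eqxx //= (bigD1 t) /=; last by rewrite eqxx orbT eq_sym st.
  by rewrite big1 ?addr0 // => w; case/andP=> /andP[/orP[]/eqP->]; rewrite ?eqxx ?andbF.
move/eqP: ab => ab; move/eqP: au => au; move/eqP: av => av; move/eqP: ab' => ab'.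
move/eqP: bu => bu; move/eqP: bv => bv; move/eqP: bb' => bb'; move/eqP: uv => uv.
move/eqP: ub' => ub'; move/eqP: vb' => vb'.
have Au : x v + x a = r * x u.
  rewrite -xA two; last by apply/eqP => /esym.
  apply: eq_bigl => w; rewrite /= /pendant_triangle_rel !inE.
  repeat (case: eqP => ?; try (exfalso; congruence)); by [].
have Av : x u + x a = r * x v.
  rewrite -xA two; last by apply/eqP => /esym.
  apply: eq_bigl => w; rewrite /= /pendant_triangle_rel !inE.
  repeat (case: eqP => ?; try (exfalso; congruence)); by [].
(* Adding [x z] turns the sum into one over the closed neighbourhood, which is the same for all
   these vertices. *)
have nbr (z : T) : z <> u -> z <> v -> z <> a ->
    r * x z + x z = \sum_(w | (w != u) && (w != v)) x w.
  move=> zu zv za; rewrite -xA addrC [RHS](bigD1 z) /=; last first.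
    by apply/andP; split; apply/eqP.
  congr (_ + _); apply: eq_bigl => w; rewrite /= /pendant_triangle_rel !inE.
  repeat (case: eqP => ?; try (exfalso; congruence)); by [].
have Ab : x a + x b' <= r * x b.
  rewrite -xA two; last by apply/eqP.
  rewrite [leLHS]big_mkcond [leRHS]big_mkcond; apply: ler_sum => w _.
  suff : (w == a) || (w == b') -> edge (b : H) w.
    by case: ifP => [_ ->//|_ _]; case: ifP => // _; apply: ltW.
  rewrite /= /pendant_triangle_rel !inE.
  repeat (case: eqP => ?; try (exfalso; congruence)); by [].
have bb : r * x b + x b = r * x b' + x b' by rewrite !nbr; congruence.
(* [Au] and [Av] give (r + 1)(x_u - x_v) = 0, hence (r - 1) x_u = x_a; [Ab] and x_b = x_b' give (r -
   1) x_b >= x_a. *)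
have xuv : x u = x v by nra.
have xbb : x b = x b' by nra.
have xub : x u <= x b by nra.
have : \sum_y x y * \sum_(z | edge (y : H) z) x z = r * \sum_y x y ^+ 2.
  by rewrite mulr_sumr; apply: eq_bigr => y _; rewrite xA; ring.
have := rayleigh (G := S) G0 x.
have le2 : spectral_radius R S * \sum_y x y ^+ 2 <= r * \sum_y x y ^+ 2.
  by rewrite ler_wpM2r // sumr_ge0 // => y _; apply: sqr_ge0.
rewrite !quadratic_mkcond => QS QH.
have := big_delta2 u v (fun y z => x y * x z); have := big_delta2 v u (fun y z => x y * x z).
have := big_delta2 b u (fun y z => x y * x z); have := big_delta2 u b (fun y z => x y * x z).
have := big_delta2 b v (fun y z => x y * x z); have := big_delta2 v b (fun y z => x y * x z).
move=> E1 E2 E3 E4 E5 E6.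
have : \sum_y \sum_z (edge (y : S) z)%:R * (x y * x z) + x u * x v + x v * x u =
  \sum_y \sum_z (edge (y : H) z)%:R * (x y * x z) + x b * x u + x u * x b + x b * x v + x v * x b.
  rewrite -E1 -E2 -E3 -E4 -E5 -E6 -!big_split /=; apply: eq_bigr => y _.
  rewrite -!big_split /=; apply: eq_bigr => z _.
  rewrite -!mulrDl -!natrD; congr (_%:R * _).
  rewrite /split_join_rel /pendant_triangle_rel !inE.
  repeat (case: eqP => ?; try (exfalso; congruence)); by [].
have xu := xgt0 u; rewrite -xuv; nra.
Qed.

(** * From the spectral hypothesis to the conclusion *)

Lemma min_degree_le (G : sgraph) (x : G) : (min_degree G <= degree x)%N.
Proof.
rewrite /min_degree; have := mem_index_enum x.
elim: (index_enum G) => // y s IH; rewrite inE big_cons geq_min => /orP[/eqP->|/IH->].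
  by rewrite leqnn.
by rewrite orbT.
Qed.

(** Since rho > n - 3 and t^2 - t increases there, the degree sum exceeds (n - 3)(n - 4) + 2(n - 1)
    = n^2 - 5n + 10; integrality turns 10 into 11. *)
Lemma degree_sum_lower (R : realType) (G : sgraph) : (5 <= #|G|)%N ->
  (2 <= min_degree G)%N ->
  spectral_radius R (G2 #|G|) <= spectral_radius R G ->
  (#|G| * #|G| + 11 <= \sum_(x : G) degree x + 5 * #|G|)%N.
Proof.
move=> n5 d2 le; have G0 : (0 < #|G|)%N by lia.
have lt := lt_le_trans (spectral_radius_G2_gt R n5) le.
have h := spectral_radius_degree_bound R G0 (fun x => leq_trans d2 (min_degree_le x)).
have n5R : 5 <= #|G|%:R :> R by rewrite (ler_nat _ 5).
rewrite leqNgt; apply/negP => small.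
have : (\sum_(x : G) degree x + 5 * #|G| + 1)%N%:R <= (#|G| * #|G| + 11)%N%:R :> R.
  by rewrite ler_nat; lia.
rewrite natrD [X in X + _]natrD (natrM _ 5) [leRHS]natrD natrM => ub.
move: lt h; set r := spectral_radius R G => lt h.
nra.
Qed.

Lemma isomorphic_trans (G H K : sgraph) :
  isomorphic G H -> isomorphic H K -> isomorphic G K.
Proof.
case=> f [bf fe] [g [bg ge]]; exists (g \o f); split; first exact: bij_comp.
by move=> x y; rewrite /= ge fe.
Qed.

Lemma hamiltonian_or_G2 (R : realType) (G : sgraph) :
  (14 <= #|G|)%N -> (2 <= min_degree G)%N ->
  spectral_radius R (G2 #|G|) <= spectral_radius R G ->
  hamiltonian G \/ isomorphic G (G2 #|G|).
Proof.
move=> n14 d2 le; have [hG|nh] := pselect (hamiltonian G); [by left|right].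
have n5 : (5 <= #|G|)%N by lia.
have [a [b [u [v [U sub]]]]] := nonhamiltonian_structure (@edge_sym G)
  (@edge_irrefl G) nh n14 (fun x => leq_trans d2 (min_degree_le x))
  (degree_sum_lower n5 d2 le).
have iso := split_join_iso U; have rE := spectral_radius_iso R iso.
have rgt : 11 < spectral_radius R (split_join a b u v).
  rewrite rE; apply: le_lt_trans (spectral_radius_G2_gt R n5).
  by rewrite lerBrDr -natrD ler_nat.
case: sub => sub.
  apply: isomorphic_trans iso; exists id; split; first by exists id.
  move=> x y /=; symmetry.
  apply: (spectral_radius_subgraph_eq (R := R) (c := a) (es := split_join_sym a b u v)
    (ei := split_join_irrefl a b u v)) => //.
  - by move=> w wa; rewrite /split_join_rel eq_sym wa inE eqxx.
  - by apply: lt_trans rgt.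
  - by rewrite -/(split_join a b u v) rE.
have [b' b'P] : exists b', b' \notin [:: a; b; u; v].
  have /set0Pn[b'] : ~: [set x in [:: a; b; u; v]] != set0.
    have c4 : #|[set x in [:: a; b; u; v]]| = 4 by rewrite cardsE (card_uniqP U).
    by rewrite -card_gt0; have := cardsC [set x in [:: a; b; u; v]]; lia.
  by rewrite inE in_set => h; exists b'.
have U' : uniq [:: a; b; u; v; b'].
  by rewrite -[X in uniq X]/(rcons [:: a; b; u; v] b') rcons_uniq b'P.
have lt1 : 1 < spectral_radius R (split_join a b u v) by apply: lt_trans rgt; rewrite ltr1n.
(* The second shape has spectral radius below that of [G2], and so does its subgraph [G], against
   the hypothesis. *)
have := lt_le_trans (pendant_triangle_lt U' lt1); rewrite rE => /(_ _ le).
have G0 : (0 < #|G|)%N by lia.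
have := spectral_radius_subgraph_le R (pendant_triangle_sym a u v)
  (pendant_triangle_irrefl a u v) G0 sub.
by rewrite leNgt => /negPf->.
Qed.

Theorem theorem2 (R : realType) :
  (forall (n : nat) (G : sgraph),
      (14 <= n)%N -> #|G| = n -> (2 <= min_degree G)%N ->
      spectral_radius R (G2 n) <= spectral_radius R G ->
      hamiltonian G \/ isomorphic G (G2 n))
  /\
  ((spectral_radius R (G2 7)
      < spectral_radius R
          (graph_join (complete_graph 3) (copies 4 (complete_graph 1)))
    /\ ~ hamiltonian
          (graph_join (complete_graph 3) (copies 4 (complete_graph 1))))
   /\
   (spectral_radius R (G2 9)
      < spectral_radius R
          (graph_join (complete_graph 4) (copies 5 (complete_graph 1)))
    /\ ~ hamiltonian
          (graph_join (complete_graph 4) (copies 5 (complete_graph 1))))).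
Proof.
split; [|split; split].
- by move=> n G n14 Gn; rewrite -Gn; apply: hamiltonian_or_G2; rewrite Gn.
(* The rational 9/2 separates the two radii. The weights 45, 36, 20 turn the inequalities for the
   last two cells of [G2 7] into equalities; 3 and 2 approximate the Perron vector of the join. *)
- apply: (@le_lt_trans _ _ (9 / 2)).
    by apply: (@spectral_radius_G2_le R 7 3 _ 45 36 20) => //=; lra.
  by apply: (@spectral_radius_join_gt R 3 4 _ 3 2) => //=; rewrite ?pnatr_eq0 //; lra.
- exact: join_nonhamiltonian.
(* The same scheme with 31/5 as separator; the weights 341, 310, 110 again make the last two
   inequalities equalities. *)
- apply: (@le_lt_trans _ _ (31 / 5)).
    by apply: (@spectral_radius_G2_le R 9 5 _ 341 310 110) => //=; lra.
  by apply: (@spectral_radius_join_gt R 4 5 _ 3 2) => //=; rewrite ?pnatr_eq0 //; lra.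
- exact: join_nonhamiltonian.
Qed.
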